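(* Let $\delta>0$ and let $\mu$ be a probability distribution on $\mathbb{R}$ defined by a unimodal density function $f$. Then there is a shift-invariant one-sample estimator $e:\mathbb{R}\to\mathbb{R}$ that is optimal.
   Context: A density function $f:\mathbb{R}\to[0,\infty)$ is unimodal if for all $y$ the set $\{x: f(x)\ge y\}$ is convex. For $\theta\in\mathbb{R}$, $\mu_\theta(A)=\mu(\{x:x+\theta\in A\})$. A one-sample estimator is a (Borel) measurable function $e:\mathbb{R}\to\mathbb{R}$. Its ($\delta$-)quality is $Q(e)=\inf_{\theta\in\mathbb{R}}\mu_\theta(\{x:|e(x)-\theta|<\delta\})$. It is shift-invariant if $e(x+c)=e(x)+c$ for all $x,c\in\mathbb{R}$. It is optimal (for the fixed $\delta$) if $Q(e)\ge Q(e')$ for all one-sample estimators $e'$. *)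

(* Defs.v *)
From HB Require Import structures.
From mathcomp Require Import all_boot all_order all_algebra.
From mathcomp Require Import all_classical all_reals all_analysis.

Set Implicit Arguments.
Unset Strict Implicit.
Unset Printing Implicit Defensive.

Import Order.TTheory GRing.Theory Num.Theory.
Import numFieldNormedType.Exports.

Local Open Scope classical_set_scope.
Local Open Scope ring_scope.

Definition unimodal (R : realType) (f : R -> R) : Prop :=
  forall y : R, convex_set [set x : R^o | y <= f x].

(* The normalization \int f = 1 is not listed: it follows from mu being a
   probability.  [measurable] on R is the Borel sigma-algebra. *)
Definition has_density (R : realType) (mu : probability R R) (f : R -> R)
    : Prop :=
  [/\ forall x, 0 <= f x,
      measurable_fun [set: R] f &
      forall A : set R, measurable A ->
        mu A = (\int[lebesgue_measure]_(x in A) (f x)%:E)%E].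

Definition translate (R : realType) (mu : probability R R) (theta : R)
    (A : set R) : \bar R :=
  mu [set x | A (x + theta)].

Definition one_sample_estimator (R : realType) (e : R -> R) : Prop :=
  measurable_fun [set: R] e.

Definition quality (R : realType) (mu : probability R R) (delta : R)
    (e : R -> R) : \bar R :=
  ereal_inf (range (fun theta : R =>
    translate mu theta [set x | `|e x - theta| < delta])).

Definition shift_invariant (R : realType) (e : R -> R) : Prop :=
  forall x c : R, e (x + c) = e x + c.

Definition optimal (R : realType) (mu : probability R R) (delta : R)
    (e : R -> R) : Prop :=
  forall e' : R -> R, one_sample_estimator e' ->
    (quality mu delta e' <= quality mu delta e)%E.

(* Main.v *)
Require Import Defs.
From mathcomp Require Import all_boot all_order all_algebra.
From mathcomp Require Import all_classical all_reals all_analysis.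
From mathcomp Require Import measurable_realfun ring lra.

Set Implicit Arguments.
Unset Strict Implicit.
Unset Printing Implicit Defensive.

Import Order.TTheory GRing.Theory Num.Theory.
Import numFieldNormedType.Exports.

Local Open Scope classical_set_scope.
Local Open Scope ring_scope.

(** A shift-invariant estimator has the form [x - c], and for every [theta] it
    succeeds on exactly the samples of [ball c delta]; its quality is therefore
    [mu (ball c delta)].  Two facts give the theorem.

    First, the concentration [c |-> mu (ball c delta)] attains its maximum: it
    is continuous because [mu] has a density ([continuous_concentration]), and
    it is small far away because [mu] is tight, so that the search can be
    restricted to a compact interval ([exists_max_concentration]).

    Second, no estimator beats the largest concentration [m]
    ([quality_le_concentration]).  Let [theta] be uniform on the long interval
    [[-L, L]], and regard the observation [y = x + theta] as the variable to
    integrate last.  For a fixed [y], success means that [x] is within [delta]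
    of [y - e y], which has [mu]-probability at most [m].  Apart from a set of
    samples [x] of small probability, [y] ranges over [[-(K + L), K + L]].  The
    average success over [[-L, L]], and with it the quality, is thus at most
    [m (K + L) / L] plus a small error ([averaged_quality]); the excess over
    [m] vanishes as [L] grows and then [K]. *)

(** * Change of variables between parameter and observation *)

Lemma lebesgue_measure_translate (R : realType) (c : R) (A : set R) :
  measurable A ->
  lebesgue_measure [set x : R | A (c + x)] = lebesgue_measure A.
Proof.
move=> mA.
pose T : measurableTypeR R -> measurableTypeR R := fun x => c + x.
have mT : measurable_fun [set: measurableTypeR R] T by exact: measurable_funD.
symmetry.
apply: (@lebesgue_measure_unique R (pushforward lebesgue_measure T)) => //.
move=> X /ocitvP[->|[[a b] /= ab ->]]; first by rewrite !measure0.
rewrite /pushforward.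
have -> : T @^-1` `]a, b] = `]a - c, b - c]%classic.
  by apply/seteqP; split => x /=; rewrite /T !in_itv /= ltrBlDl lerBrDl.
rewrite !lebesgue_measure_itv /= !lte_fin ltrD2r ab.
by rewrite -!EFinB; congr EFin; lra.
Qed.

(** Passing from the parameter [theta] to the observation [x + theta], with the
    noise [x] fixed, is a translation on each vertical section. *)
Lemma shear_product_measure (R : realType)
    (mu : {measure set R -> \bar R}) (A : set (R * R)) : measurable A ->
  ((mu \x lebesgue_measure) [set p : R * R | A (p.1, (p.1 + p.2)%R)] =
   (mu \x lebesgue_measure) A)%E.
Proof.
move=> mA; apply: eq_integral => x _ /=.
rewrite -(@lebesgue_measure_translate R x (xsection A x)); last first.
  exact: measurable_xsection.
by congr lebesgue_measure; apply/seteqP; split => y; rewrite /xsection /= !inE.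
Qed.

Lemma product_measure_ysection (d1 d2 : measure_display)
    (T1 : measurableType d1) (T2 : measurableType d2) (R : realType)
    (m1 : {sigma_finite_measure set T1 -> \bar R})
    (m2 : {sigma_finite_measure set T2 -> \bar R}) (A : set (T1 * T2)) :
  measurable A -> ((m1 \x m2) A = \int[m2]_y m1 (ysection A y))%E.
Proof.
move=> mA.
apply: (@product_measure_unique _ _ _ _ R m1 m2 (product_measure2 m1 m2)) => //.
exact: (product_measure2E m1 m2).
Qed.

(** * No estimator beats the largest concentration *)

Lemma tight_probability (R : realType) (mu : probability R R) (eps : R) :
  0 < eps -> exists2 K : R, 0 < K & (mu (~` `[(- K)%R, K]) < eps%:E)%E.
Proof.
move=> eps0.
pose F n : set R := ~` `[- n%:R, n%:R].
have mF n : measurable (F n) by apply: measurableC; exact: measurable_itv.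
have F0 : \bigcap_n F n = set0.
  rewrite -subset0 => t /(_ (Num.bound t) I); apply.
  by rewrite /= in_itv /= -ler_norml ltW // unstable.ltr_norm_bound.
have : mu (F n) @[n --> \oo] --> mu (\bigcap_n F n).
  apply: nonincreasing_cvg_mu => //.
  - by rewrite (le_lt_trans (probability_le1 _ _)) ?ltry.
  - by rewrite F0.
  - move=> m n mn; apply/subsetPset; apply: subsetC => x /=.
    rewrite !in_itv /= -!ler_norml => /le_trans; apply.
    by rewrite ler_nat.
rewrite F0 measure0 => /fine_cvgP[_] /cvgrPdist_lt /(_ _ eps0)[N _].
move=> /(_ N.+1) /=.
rewrite sub0r normrN => /(_ (leqnSn _)) h.
exists N.+1%:R; first by rewrite ltr0n.
have fF : mu (F N.+1) \is a fin_num by rewrite fin_num_measure.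
by rewrite -(fineK fF) lte_fin (le_lt_trans (ler_norm _)).
Qed.

(** In the coordinates (noise, observation), the pairs for which [e] succeeds,
    with noise and parameter truncated to bounded intervals. *)
Lemma measurable_error_set (R : realType) (e : R -> R) (delta K L : R) :
  measurable_fun setT e ->
  measurable [set p : R * R | [/\ `|p.1| <= K, `|p.2 - p.1| <= L &
     `|e p.2 - (p.2 - p.1)| < delta]].
Proof.
move=> me.
have m1 : measurable_fun [set: R * R] (fun p => `|p.1|).
  by apply: measurableT_comp => //; exact: measurable_fst.
have m3 : measurable_fun [set: R * R] (fun p => p.2 - p.1).
  by apply: measurable_funB.
have m2 : measurable_fun [set: R * R] (fun p => `|p.2 - p.1|).
  by apply: measurableT_comp.
have m4 : measurable_fun [set: R * R] (fun p => `|e p.2 - (p.2 - p.1)|).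
  apply: measurableT_comp => //; apply: measurable_funB => //.
  by apply: measurableT_comp.
rewrite (_ : [set p | _] =
  (fun p : R * R => `|p.1|) @^-1` `]-oo, K]%classic `&`
  (fun p : R * R => `|p.2 - p.1|) @^-1` `]-oo, L]%classic `&`
  (fun p : R * R => `|e p.2 - (p.2 - p.1)|) @^-1` `]-oo, delta[%classic).
apply: measurableI; first apply: measurableI; rewrite -[X in measurable X]setTI.
- by apply: m1 => //; exact: measurable_itv.
- by apply: m2 => //; exact: measurable_itv.
- by apply: m4 => //; exact: measurable_itv.
by apply/seteqP; split => p /=; rewrite !in_itv /=; [case|case; case].
Qed.

(** Both sides, up to the factor 2, bound the measure under [mu \x lebesgue]
    of the pairs (noise, parameter) for which [e] succeeds, with the noise in
    [[-K, K]] and the parameter in [[-L, L]].  Integrated over the parameter,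
    it is at least [(q - eps) * 2L]; after the shear it is integrated over the
    observation, where each section has measure at most [m] and the
    observation lies in an interval of length [2(K + L)]. *)
Lemma averaged_quality (R : realType) (mu : probability R R) (delta : R)
    (e : R -> R) (m K L q eps : R) :
  measurable_fun setT e -> 0 < K -> 0 < L ->
  (q%:E <= quality mu delta e)%E ->
  (mu (~` `[(- K)%R, K]) <= eps%:E)%E ->
  (forall c, mu (ball c delta) <= m%:E)%E ->
  (q - eps) * L <= m * (K + L).
Proof.
move=> me K0 L0 qQ muK hm.
pose A : set (R * R) := [set p : R * R | [/\ `|p.1| <= K, `|p.2 - p.1| <= L &
     `|e p.2 - (p.2 - p.1)| < delta]].
have mA : measurable A by exact: measurable_error_set.
pose B : set (R * R) := [set p : R * R | A (p.1, p.1 + p.2)].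
have mB : measurable B.
  rewrite -[B]setTI.
  apply: (_ : measurable_fun setT (fun p : R * R => (p.1, p.1 + p.2))) => //.
  by apply: measurable_fun_pair => //; apply: measurable_funD.
have m0 : 0 <= m by have := hm 0; rewrite -lee_fin; apply: le_trans.
have [qe|qe] := leP (q - eps) 0.
  rewrite (le_trans (mulr_le0_ge0 qe (ltW L0))) // mulr_ge0 //.
  by rewrite addr_ge0 // ltW.
have mI (a : R) : measurable (`[- a, a]%classic : set R).
  exact: measurable_itv.
have lenI (a : R) : 0 < a ->
    lebesgue_measure (`[- a, a]%classic : set R) = (a *+ 2)%:E.
  move=> a0; rewrite lebesgue_measure_itv /= lte_fin ifT; last by lra.
  by rewrite -EFinB opprK mulr2n.
suff : (((q - eps) * (L *+ 2))%:E <= (m * ((K + L) *+ 2))%:E)%E.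
  by rewrite lee_fin !mulr2n; nra.
apply: (@le_trans _ _ ((mu \x lebesgue_measure) B)%E).
  rewrite product_measure_ysection // EFinM -lenI // -integral_cst //.
  apply: (@le_trans _ _ (\int[lebesgue_measure]_(y in `[(- L)%R, L])
      mu (ysection B y))%E); last first.
    apply: ge0_subset_integral => //; exact: measurable_fun_ysection.
  apply: ge0_le_integral => //.
  - by move=> x _; rewrite lee_fin ltW.
  - apply: measurable_funTS; exact: measurable_fun_ysection.
  move=> t; rewrite /= in_itv /= -ler_norml => tL.
  (* For each parameter, truncating the noise to [[-K, K]] costs at most eps. *)
  rewrite EFinB leeBlDr //.
  apply: le_trans qQ _.
  apply: (@le_trans _ _ (translate mu t [set x | `|e x - t| < delta])).
    by apply: ereal_inf_lbound; exists t.
  have mD : measurable [set x : R | `|e (x + t) - t| < delta].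
    rewrite (_ : [set x | _] =
        (fun x : R => `|e (x + t) - t|) @^-1` `]-oo, delta[%classic); last first.
      by apply/seteqP; split => x /=; rewrite in_itv.
    rewrite -[X in measurable X]setTI.
    suff : measurable_fun setT (fun x : R => `|e (x + t) - t|).
      by apply => //; exact: measurable_itv.
    apply: measurableT_comp => //; apply: measurable_funB => //.
    by apply: measurableT_comp => //; exact: measurable_funD.
  have mS : measurable (ysection B t) by exact: measurable_ysection.
  have mC : measurable (~` `[- K, K]%classic : set R) by exact: measurableC.
  apply: (@le_trans _ _ (mu (ysection B t `|` ~` `[(- K)%R, K]))).
    apply: le_measure; rewrite ?inE.
    - exact: mD.
    - exact: measurableU.
    - move=> x /= xt; have [xK|xK] := leP `|x| K.
        by left; rewrite /ysection /= inE /B /A /= addrAC subrr add0r.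
      by right; rewrite in_itv /= -ler_norml leNgt xK.
  apply: (le_trans (measureU2 _ _ _)) => //.
  by rewrite leeD2l.
rewrite shear_product_measure // product_measure_ysection //.
rewrite EFinM -lenI ?addr_gt0 // -integral_cst //.
have -> : (fun y => mu (ysection A y)) =
    (fun y => mu (ysection A y)) \_ `[- (K + L), K + L].
  apply/funext => y; rewrite patchE; case: ifPn => // /negP yKL.
  rewrite (_ : ysection A y = set0) ?measure0 //.
  rewrite -subset0 => x; rewrite /ysection /= inE => -[/= xK yxL _]; apply: yKL.
  rewrite inE /= in_itv /= -ler_norml.
  by rewrite -(subrK x y) addrC (le_trans (ler_normD _ _)) // lerD.
rewrite -integral_mkcond; apply: ge0_le_integral => //.
  apply: measurable_funTS; exact: measurable_fun_ysection.
move=> y _; rewrite /=; apply: le_trans (hm (y - e y)).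
apply: le_measure; rewrite ?inE //; first exact: measurable_ysection.
  exact: measurable_ball.
move=> x; rewrite /ysection /= inE => -[_ _] /=; rewrite /ball /= -normrN.
by congr (`|_| < _); ring.
Qed.

Lemma quality_le_concentration (R : realType) (mu : probability R R)
    (delta : R) (e : R -> R) (m : R) :
  measurable_fun setT e -> (forall c, mu (ball c delta) <= m%:E)%E ->
  (quality mu delta e <= m%:E)%E.
Proof.
move=> me hm; rewrite leNgt; apply/negP => mQ.
have [q qQ mq] : exists2 q : R, (q%:E <= quality mu delta e)%E & m < q.
  case: (quality mu delta e) mQ => [r| |] // mr.
    by exists r => //; rewrite -lte_fin.
  by exists (m + 1); rewrite ?leey // ltrDl.
pose eps := (q - m) / 2.
have eps0 : 0 < eps by rewrite /eps; lra.
have [K K0 /ltW muK] := @tight_probability R mu _ eps0.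
have m0 : 0 <= m by have := hm 0; rewrite -lee_fin; apply: le_trans.
(* With this [L], [averaged_quality] reads m * K + 1 <= m * K. *)
pose L := (m * K + 1) / eps.
have L0 : 0 < L by rewrite divr_gt0 // ltr_wpDl // mulr_ge0 // ltW.
have := averaged_quality me K0 L0 qQ muK hm.
have -> : q - eps = m + eps by rewrite /eps; lra.
have : eps * L = m * K + 1 by rewrite /L mulrC divfK // gt_eqF.
nra.
Qed.

(** * The concentration attains its maximum *)

(** Moving the centre from [b] to [a] adds to the ball only points close to one
    of its end points [b + delta] and [b - delta]; by absolute continuity of
    the integral of the density, such small neighbourhoods have small mass. *)
Lemma continuous_concentration (R : realType) (mu : probability R R)
    (f : R -> R) (delta : R) :
  has_density mu f -> continuous (fun c => fine (mu (ball c delta))).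
Proof.
move=> [f0 mf muf].
have intf : lebesgue_measure.-integrable [set: R] (EFin \o f).
  apply/integrableP; split; first exact/measurable_EFinP.
  under eq_integral => x _ do rewrite /= ger0_norm //.
  by rewrite -muf // probability_setT ltry.
have mB (c r : R) : measurable (ball c r) by exact: measurable_ball.
move=> c; apply/cvgrPdist_lt => eps eps0.
have eps20 : 0 < eps / 2 by rewrite divr_gt0.
have [d [d0 hd]] := integral_normr_continuous intf eps20.
have {}hd (x r : R) : 0 < r -> r *+ 2 < d -> fine (mu (ball x r)) < eps / 2.
  move=> r0 rd; rewrite muf //.
  have rd' : (lebesgue_measure (ball x r) < d%:E)%E.
    by rewrite lebesgue_measure_ball ?ltW // lte_fin.
  have := hd _ (mB x r) rd'.
  by under eq_Rintegral do rewrite ger0_norm //.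
have near_le (a b r : R) : 0 < r -> r *+ 2 < d -> `|a - b| < r ->
    fine (mu (ball a delta)) < fine (mu (ball b delta)) + eps.
  move=> r0 rd abr.
  have mF (x s : R) : (fine (mu (ball x s)))%:E = mu (ball x s).
    by rewrite fineK // fin_num_measure.
  suff : ((fine (mu (ball a delta)))%:E <= (fine (mu (ball b delta)))%:E +
      ((fine (mu (ball (b + delta)%R r)))%:E +
       (fine (mu (ball (b - delta)%R r)))%:E))%E.
    rewrite -!EFinD lee_fin.
    by have := hd (b + delta) r r0 rd; have := hd (b - delta) r r0 rd; lra.
  rewrite !mF.
  have mU : measurable (ball (b + delta)%R r `|` ball (b - delta)%R r).
    exact: measurableU.
  apply: le_trans (leeD2l _ (measureU2 mu (mB _ _) (mB _ _))).
  apply: le_trans (measureU2 mu (mB _ _) mU).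
  apply: le_measure; rewrite ?inE //; first exact: measurableU.
    move=> x; rewrite /ball /= => xa.
    have [xb|xb] := ltP `|b - x| delta; first by left.
    right; move: xa abr xb; rewrite !ltr_norml ler_normr.
    move=> /andP[? ?] /andP[? ?] /orP[?|?].
      by right; apply/andP; lra.
    by left; apply/andP; lra.
have r0 : 0 < d / 3 by rewrite divr_gt0.
have rd : d / 3 *+ 2 < d by rewrite mulr2n; lra.
have cB : \forall y \near c, ball c (d / 3) y by exact: nbhsx_ballx.
near=> y.
have cy : `|c - y| < d / 3.
  near: y; exact: cB.
have := near_le _ _ _ r0 rd cy; rewrite distrC in cy.
have := near_le _ _ _ r0 rd cy.
by rewrite ltr_norml => ? ?; apply/andP; lra.
Unshelve. all: by end_near. Qed.

(** If some ball, say centred at [a], has positive mass, tightness gives a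
    bounded interval outside of which every ball has less mass than that one;
    the extreme value theorem applies on that interval. *)
Lemma exists_max_concentration (R : realType) (mu : probability R R)
    (f : R -> R) (delta : R) :
  0 < delta -> has_density mu f ->
  exists c0, forall c, (mu (ball c delta) <= mu (ball c0 delta))%E.
Proof.
move=> delta0 hf.
pose G c := fine (mu (ball c delta)).
have mB (c r : R) : measurable (ball c r) by exact: measurable_ball.
have GE c : mu (ball c delta) = (G c)%:E by rewrite fineK // fin_num_measure.
have G0 c : 0 <= G c by rewrite fine_ge0.
suff [c0 hc0] : exists c0, forall c, G c <= G c0.
  by exists c0 => c; rewrite !GE lee_fin.
have [[a Ga]|/forallNP Gn] := pselect (exists a, 0 < G a); last first.
  exists 0 => c; rewrite (le_trans _ (G0 _)) // leNgt; exact/negP/Gn.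
have [K K0 muK] := @tight_probability R mu _ Ga.
(* Balls centred outside [[-T, T]] miss [[-K, K]], and [a] lies in [[-T, T]]. *)
pose T := K + delta + `|a|.
have T0 : - T <= T by rewrite /T; have := normr_ge0 a; lra.
have cG : {within `[- T, T], continuous G}.
  by apply: continuous_subspaceT; exact: continuous_concentration hf.
have [c0 _ hc0] := EVT_max T0 cG.
exists c0 => c.
have [cT|cT] := leP `|c| T.
  by apply: hc0; rewrite in_itv /= -ler_norml.
apply: (@le_trans _ _ (G a)); last first.
  by apply: hc0; rewrite in_itv /= -ler_norml /T; lra.
rewrite -lee_fin -GE (le_trans _ (ltW muK)) //.
apply: le_measure; rewrite ?inE //; first exact: measurableC (measurable_itv _).
move=> x /=; rewrite /ball /= in_itv /= -ler_norml => xc.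
apply/negP; rewrite -ltNge; rewrite /T in cT.
have := normr_ge0 a; have := ler_normD x (c - x); rewrite subrKC; lra.
Qed.

(** * Optimality of the best translation *)

Theorem mainTheorem2 (R : realType) (delta : R) (hdelta : 0 < delta)
    (mu : probability R R) (f : R -> R)
    (hdensity : has_density mu f) (hunimodal : unimodal f) :
  exists e : R -> R,
    [/\ one_sample_estimator e, shift_invariant e & optimal mu delta e].
Proof.
have [c0 hc0] := exists_max_concentration hdelta hdensity.
have muE c : mu (ball c delta) = (fine (mu (ball c delta)))%:E.
  by rewrite fineK // fin_num_measure //; exact: measurable_ball.
exists (fun x => x - c0); split.
- exact: measurable_funB.
- by move=> x c; rewrite addrAC.
move=> e' me'; apply: (@le_trans _ _ (mu (ball c0 delta))).
  by rewrite muE; apply: quality_le_concentration => // c; rewrite -muE.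
apply: le_ereal_inf_tmp => _ [t _ <-]; rewrite /translate.
rewrite (_ : [set x | _] = ball c0 delta) //.
have shift x : x + t - c0 - t = x - c0 by ring.
by apply/seteqP; split => x; rewrite /ball /= shift distrC.
Qed.
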